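(* Let $a,k\in\mathbb{N}\setminus\{1\}$, let $F=\{1,a,a^2,\dots,a^{k-1}\}$, and let $S(a,k)=\{n\in\mathbb{N}:\nu_a(n)\equiv k-1 \pmod k\}$. Let $N\in\mathbb{N}$. If $X\subseteq\mathbb{N}$ is multiplicatively $F$-syndetic, then $|X\cap[N]|\geq|S(a,k)\cap[N]|$.
   Context: $\mathbb{N}=\{1,2,3,\dots\}$, $[N]=\{1,\dots,N\}$. For an integer $a\ge 2$, $\nu_a(n)=\max\{j\in\mathbb{N}\cup\{0\}:a^j\mid n\}$. For a non-empty finite $F\subset\mathbb{N}$, $X\subseteq\mathbb{N}$ is multiplicatively $F$-syndetic if for every $n\in\mathbb{N}$ there is $t\in F$ with $nt\in X$. *)

(* Defs.v *)
From mathcomp Require Export all_boot finmap.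
From mathcomp Require Export boolp classical_sets cardinality.

Set Implicit Arguments.
Unset Strict Implicit.
Unset Printing Implicit Defensive.

Local Open Scope classical_set_scope.

Definition posnat : set nat := [set n | 0 < n].

Definition upto (N : nat) : set nat := [set n | 1 <= n <= N].

(* The range j <= n loses nothing when 1 < a and 0 < n, since then a ^ j %| n
   forces j < a ^ j <= n; see [nuP]. *)
Definition nu (a n : nat) : nat := \max_(j < n.+1 | a ^ j %| n) j.

Definition mult_syndetic (F X : set nat) : Prop :=
  forall n, posnat n -> exists t, F t /\ X (n * t).

Definition geomF (a k : nat) : set nat := [set a ^ i | i in [set i | i < k]].

Definition Sset (a k : nat) : set nat :=
  [set n | posnat n /\ nu a n = k.-1 %[mod k]].

(* [fset_set] sends infinite sets to the empty set; only used on finite sets,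
   see [finite_upto]. *)
Definition ncard (A : set nat) : nat := #|` fset_set A|.

Lemma nuP (a n j : nat) : 1 < a -> 0 < n -> (a ^ j %| n) = (j <= nu a n).
Proof.
move=> a1 n0; apply/idP/idP => [dj|le_j].
  have jn : j < n.+1.
    by rewrite ltnS (leq_trans (ltnW (ltn_expl j a1))) // dvdn_leq.
  exact: (@leq_bigmax_cond _ _ (fun i : 'I_n.+1 => nat_of_ord i) (Ordinal jn)).
apply: dvdn_trans (dvdn_exp2l a le_j) _; rewrite /nu.
by elim/big_ind: _ => // x y; case: (leqP x y).
Qed.

Lemma finite_upto (N : nat) (A : set nat) : finite_set (A `&` upto N).
Proof.
apply: (sub_finite_set _ (finite_II N.+1)) => n [_ /andP[_ nN]].
by rewrite /= ltnS.
Qed.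

(* Main.v *)
Require Import Defs.
From mathcomp Require Import all_boot finmap.
From mathcomp Require Import boolp classical_sets cardinality.

Set Implicit Arguments.
Unset Strict Implicit.
Unset Printing Implicit Defensive.

Local Open Scope classical_set_scope.

(** Every [s] in [S(a,k)] is [n * a ^ (k - 1)] with [k] dividing [nu a n], and
    syndeticity gives [i < k] with [x := n * a ^ i] in [X]; moreover [x <= s].
    Since [nu a x = nu a n + i], the exponent [i] is [nu a x %% k], so [s] is
    recovered from [x]: it is the image of [x] under a map that depends on [a]
    and [k] only. Hence [X] has at least as many elements up to [N]. *)

(** For composite [a], [nu a] is not additive on all products; here it is, because [a ^ i] cancels
    from [a ^ (i + j) %| n * a ^ i]. *)
Lemma nuMX (a n i : nat) : 1 < a -> 0 < n -> nu a (n * a ^ i) = nu a n + i.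
Proof.
move=> a1 n0; have a0 : 0 < a ^ i by rewrite expn_gt0 ltnW.
have na0 : 0 < n * a ^ i by rewrite muln_gt0 n0.
have nuD j : (i + j <= nu a (n * a ^ i)) = (j <= nu a n).
  by rewrite -!nuP // expnD mulnC dvdn_pmul2r.
apply/eqP; rewrite eqn_leq [nu a n + i]addnC nuD leqnn andbT.
have le_i : i <= nu a (n * a ^ i) by rewrite -nuP // dvdn_mull.
(* Upper bound: [nuD] at [j := nu a (n * a ^ i) - i], exact by [le_i]. *)
by rewrite -leq_subLR -nuD subnKC.
Qed.

(** [nu a s] is at least its residue [k.-1], so [a ^ k.-1] divides [s]; cancelling [k.-1] leaves
    residue [0] for the cofactor. *)
Lemma Sset_factor (a k s : nat) : 1 < a -> 0 < k -> Sset a k s ->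
  exists n, [/\ 0 < n, k %| nu a n & s = n * a ^ k.-1].
Proof.
move=> a1 k0 [s0 nus].
have k1k : k.-1 %% k = k.-1 by rewrite modn_small // prednK.
have /dvdnP[n def_s] : a ^ k.-1 %| s by rewrite nuP // -[leqLHS]k1k -nus leq_mod.
have n0 : 0 < n by move: s0; rewrite /posnat /= def_s muln_gt0 => /andP[].
exists n; split=> //; move: nus; rewrite def_s nuMX // => /eqP.
by rewrite -[X in _ == X %[mod _]]add0n eqn_modDr mod0n.
Qed.

(** For [x > 0], the last term of the block [n, n * a, ..., n * a ^ k.-1] containing [x], where
    [k %| nu a n]. *)
Definition block_end (a k x : nat) : nat := x %/ a ^ (nu a x %% k) * a ^ k.-1.

Lemma block_endE (a k n i : nat) : 1 < a -> 0 < n -> k %| nu a n -> i < k ->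
  block_end a k (n * a ^ i) = n * a ^ k.-1.
Proof.
move=> a1 n0 /dvdnP[q nun] ik.
by rewrite /block_end nuMX // nun modnMDl modn_small // mulnK // expn_gt0 ltnW.
Qed.

Lemma sub_block_end (a k N : nat) (X : set nat) : 1 < a -> 0 < k ->
  mult_syndetic (geomF a k) X ->
  Sset a k `&` upto N `<=` block_end a k @` (X `&` upto N).
Proof.
move=> a1 k0 Xsynd s [Ss /andP[_ sN]].
have [n [n0 kn def_s]] := Sset_factor a1 k0 Ss.
have [_ [[i ik <-] Xx]] := Xsynd n n0.
exists (n * a ^ i); last by rewrite block_endE.
split=> //; apply/andP; split; first by rewrite muln_gt0 n0 expn_gt0 ltnW.
(* Here [i <= k.-1] gives [n * a ^ i <= s <= N]. *)
apply: leq_trans sN; rewrite def_s leq_mul2l leq_pexp2l ?orbT //.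
  exact: ltnW.
by rewrite -ltnS prednK.
Qed.

Lemma ncard_le_image (A B : set nat) (f : nat -> nat) :
  finite_set A -> finite_set B -> A `<=` f @` B -> ncard A <= ncard B.
Proof.
move=> finA finB sAfB; apply: leq_trans (leq_imfset_card imfset_key f (mem (fset_set B))).
apply: fsubset_leq_card; apply/fsubsetP => x.
by rewrite in_fset_set // inE => /sAfB[y By <-]; rewrite in_imfset //= in_fset_set ?inE.
Qed.

Theorem theorem3p4 (a k N : nat) (X : set nat)
    (ha : 1 < a) (hk : 1 < k) (hN : 0 < N)
    (hX : X `<=` posnat) (hsynd : mult_syndetic (geomF a k) X) :
  ncard (Sset a k `&` upto N) <= ncard (X `&` upto N).
Proof.
apply: (@ncard_le_image _ _ (block_end a k)); [exact: finite_upto..|].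
exact: sub_block_end (ltnW hk) hsynd.
Qed.
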